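(* Let $\mathcal{C}$ be a clutter with vertex set $V(\mathcal{C})=\{t_1,\ldots,t_s\}$, let $S=K[t_1,\ldots,t_s]$ be a polynomial ring over a field $K$, and let $I(\mathcal{C})\subset S$ be its edge ideal. If $i(\mathcal{C})$ is the independent domination number and $\beta_0(\mathcal{C})$ is the independence number of $\mathcal{C}$, then $$\mathrm{v}(I(\mathcal{C}))\leq i(\mathcal{C})\leq\beta_0(\mathcal{C}).$$
   Context: A clutter $\mathcal{C}$ is a finite vertex set $V(\mathcal{C})=\{t_1,\ldots,t_s\}$ together with a family $E(\mathcal{C})$ of nonempty subsets of $V(\mathcal{C})$, called edges, none of which is included in another. The edge ideal $I(\mathcal{C})$ is generated by the monomials $t_e=\prod_{t_i\in e}t_i$, $e\in E(\mathcal{C})$. A set $A\subset V(\mathcal{C})$ is stable if it contains no edge of $\mathcal{C}$. The independence number $\beta_0(\mathcal{C})$ is the largest cardinality of a stable set. The independent domination number is $i(\mathcal{C})=\min\{|A| \colon A \text{ is a maximal (with respect to inclusion) stable set of }\mathcal{C}\}$. With the standard grading $S=\bigoplus_{d\ge0}S_d$, for a proper squarefree monomial ideal $I\subset S$ the v-number is $\mathrm{v}(I)=\min\{d\geq 0\mid \exists f\in S_d\text{ and }\mathfrak{p}\in\mathrm{Ass}(I)\text{ with }(I\colon f)=\mathfrak{p}\}$, where $\mathrm{Ass}(I)$ is the set of associated primes of $S/I$; in particular $\mathrm{v}(I)=0$ if $I$ is prime. *)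

(* Defs.v *)
From HB Require Import structures.
From mathcomp Require Import all_boot all_order all_algebra.
From mathcomp Require Import ring_quotient.
From mathcomp Require Import boolp.
From mathcomp Require Import mpoly.

Set Implicit Arguments.
Unset Strict Implicit.
Unset Printing Implicit Defensive.

Import GRing.Theory.
Local Open Scope ring_scope.

(* A clutter on the vertices t_1, ..., t_s, with t_(i+1) encoded as i : 'I_s. *)
Record clutter (s : nat) := Clutter {
  edges : {set {set 'I_s}};
  edges_nonempty : set0 \notin edges;
  edges_antichain :
    forall e f, e \in edges -> f \in edges -> e \subset f -> e = f
}.

Definition stable s (C : clutter s) : pred {set 'I_s} :=
  fun A => [forall e in edges C, ~~ (e \subset A)].

Definition independence_number s (C : clutter s) : nat :=
  \max_(A : {set 'I_s} | stable C A) #|A|.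

(* The default value s of the minimum is harmless: set0 is stable, so a maximal
   stable set exists, and every subset of 'I_s has at most s elements. *)
Definition independent_domination_number s (C : clutter s) : nat :=
  \big[minn/s]_(A : {set 'I_s} | maxset (stable C) A) #|A|.

(* Ideals are collective predicates, as in ring_quotient; the asbool `[< _ >]
   turns a proposition into a boolean membership test. *)
Definition ideal_gen (R : comNzRingType) (T : finType) (G : {set T})
    (g : T -> R) : {pred R} :=
  [pred f | `[< exists c : T -> R, f = \sum_(x in G) c x * g x >]].

Definition colon (R : comNzRingType) (I : {pred R}) (f : R) : {pred R} :=
  [pred h | h * f \in I].

(* idealr_closed includes properness. The annihilator in R of the class of g
   in R / I is {h | h * g \in I}, that is, colon I g. *)
Definition associated_prime (R : comNzRingType) (I p : {pred R}) : Prop :=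
  [/\ idealr_closed p, prime_idealr_closed p & exists g : R, colon I g =i p].

Definition edge_monomial (K : fieldType) s (e : {set 'I_s}) : {mpoly K[s]} :=
  \prod_(i in e) 'X_i.

Definition edge_ideal (K : fieldType) s (C : clutter s) : {pred {mpoly K[s]}} :=
  ideal_gen (edges C) (@edge_monomial K s).
Arguments edge_ideal K {s} C.

Definition vnumber_witness (K : fieldType) s (I : {pred {mpoly K[s]}})
    (d : nat) : Prop :=
  exists (f : {mpoly K[s]}) (p : {pred {mpoly K[s]}}),
    [/\ f \is d.-homog, associated_prime I p & colon I f =i p].

(* v(I) = d, as a relation: the minimum exists and equals d. *)
Definition is_vnumber (K : fieldType) s (I : {pred {mpoly K[s]}})
    (d : nat) : Prop :=
  vnumber_witness I d /\ forall d', vnumber_witness I d' -> (d <= d')%N.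

(* Main.v *)
From HB Require Import structures.
Require Import Defs.
From mathcomp Require Import all_boot all_order all_algebra.
From mathcomp Require Import boolp.
From mathcomp Require Import mpoly.

(** For a maximal stable set A and t_A the product of its vertices, (I : t_A)
    is the prime ideal generated by the variables outside A, i.e. the kernel of
    the morphism killing exactly these variables: every edge leaves A, and by
    maximality t_i t_A lies in I whenever i is not in A. Hence a smallest
    maximal stable set yields a v-number witness of degree i(C). *)

Set Implicit Arguments.
Unset Strict Implicit.
Unset Printing Implicit Defensive.

Import Order.TTheory GRing.Theory.
Local Open Scope ring_scope.

Section IdealGen.

Variables (R : comNzRingType) (T : finType) (G : {set T}) (g : T -> R).

Lemma ideal_gen0 : 0 \in ideal_gen G g.
Proof.
rewrite inE; apply/asboolP; exists (fun=> 0).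
by rewrite big1 // => x _; rewrite mul0r.
Qed.

Lemma ideal_genD : {in ideal_gen G g &, forall u v, u + v \in ideal_gen G g}.
Proof.
move=> u v; rewrite !inE => /asboolP[c ->] /asboolP[d ->].
apply/asboolP; exists (fun x => c x + d x).
by rewrite -big_split; apply: eq_bigr => x _; rewrite mulrDl.
Qed.

Lemma ideal_genM a : {in ideal_gen G g, forall u, a * u \in ideal_gen G g}.
Proof.
move=> u; rewrite !inE => /asboolP[c ->]; apply/asboolP.
exists (fun x => a * c x); rewrite big_distrr.
by apply: eq_bigr => x _; rewrite /= mulrA.
Qed.

Lemma ideal_gen_mem x : x \in G -> g x \in ideal_gen G g.
Proof.
move=> xG; rewrite inE; apply/asboolP; exists (fun y => (y == x)%:R).
rewrite (bigD1 x) //= eqxx mul1r big1 ?addr0 // => y /andP[_ /negPf->].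
by rewrite mul0r.
Qed.

End IdealGen.

Section Clutter.

Variables (K : fieldType) (s : nat) (C : clutter s).
Implicit Types (A e : {set 'I_s}) (h : {mpoly K[s]}).

Lemma stable0 : stable C set0.
Proof.
apply/forall_inP => e eC; rewrite subset0.
by apply: contraTneq eC => ->; exact: edges_nonempty.
Qed.

Lemma edge_monomial_dhomog A : edge_monomial K A \is #|A|.-homog.
Proof.
rewrite /edge_monomial -sum1_card.
elim/big_rec2: _ => [|i d p _ hp]; first exact: dhomog1.
by apply: dhomogM => //; rewrite dhomogX; apply/eqP/mdeg1.
Qed.

Lemma edge_monomial_neq0 A : edge_monomial K A != 0.
Proof.
apply/prodf_neq0 => i _; apply/eqP => /(congr1 (mcoeff U_(i)%MM)).
by rewrite mcoeffX eqxx mcoeff0 => /eqP; rewrite oner_eq0.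
Qed.

Lemma edge_monomial_ideal e A :
  e \in edges C -> e \subset A -> edge_monomial K A \in edge_ideal K C.
Proof.
move=> eC eA; rewrite /edge_monomial (big_setID e) /= (setIidPr eA) mulrC.
exact/ideal_genM/ideal_gen_mem.
Qed.

(** The codomain stays the full ring instead of the polynomials in the variables of [A], so that the
    difference [h - restrict_vars A h] makes sense. *)
Definition restrict_vars A : {mpoly K[s]} -> {mpoly K[s]} :=
  comp_mpoly [tuple if i \in A then 'X_i else 0 | i < s].

HB.instance Definition _ A := GRing.RMorphism.on (restrict_vars A).

Lemma restrict_varsX A i : restrict_vars A 'X_i = if i \in A then 'X_i else 0.
Proof. by rewrite /restrict_vars comp_mpolyXU -tnth_nth tnth_mktuple. Qed.

Lemma restrict_vars_edge_monomial A :
  restrict_vars A (edge_monomial K A) = edge_monomial K A.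
Proof.
by rewrite rmorph_prod; apply: eq_bigr => i iA; rewrite /= restrict_varsX iA.
Qed.

Lemma restrict_vars_ideal A h :
  stable C A -> h \in edge_ideal K C -> restrict_vars A h = 0.
Proof.
move=> /forall_inP sA; rewrite inE => /asboolP[c ->].
rewrite rmorph_sum big1 //= => e /sA /subsetPn[i ie iA].
rewrite rmorphM rmorph_prod /= (bigD1 i) //=.
by rewrite restrict_varsX (negPf iA) mul0r mulr0.
Qed.

Lemma maxset_stable_mulX A i : maxset (stable C) A -> i \notin A ->
  'X_i * edge_monomial K A \in edge_ideal K C.
Proof.
move=> /maxsetP[_ maxA] iA.
have : ~~ stable C (i |: A).
  apply/negP => /maxA /(_ (subsetUr _ _)) eqA.
  by case/negP: iA; rewrite -eqA setU11.
rewrite negb_forall_in => /exists_inP[e eC /negPn eA].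
rewrite -[X in X \in _](_ : edge_monomial K (i |: A) = _).
  exact: edge_monomial_ideal eA.
by rewrite /edge_monomial big_setU1.
Qed.

(** This gives the inclusion of the kernel in the colon ideal. The polynomials [h] with this
    property contain the constants and the variables and are closed under sums and products, hence
    are all polynomials. *)
Lemma restrict_vars_mul_ideal A h : maxset (stable C) A ->
  (h - restrict_vars A h) * edge_monomial K A \in edge_ideal K C.
Proof.
move=> maxA; set P := fun h => (h - restrict_vars A h) * edge_monomial K A
  \in edge_ideal K C.
have PM u v : P u -> P v -> P (u * v).
  move=> Pu Pv; rewrite /P rmorphM /=.
  (* With $\varphi$ for [restrict_vars A]:
     $uv-\varphi(u)\varphi(v)=v(u-\varphi(u))+\varphi(u)(v-\varphi(v))$. *)
  rewrite -[X in X \in _](_ : v * ((u - restrict_vars A u) * edge_monomial K A)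
    + restrict_vars A u * ((v - restrict_vars A v) * edge_monomial K A) = _).
    by apply: ideal_genD; apply: ideal_genM.
  by rewrite !mulrA -mulrDl mulrBr mulrBr (mulrC v u) (mulrC v) addrA subrK.
have P1 : P 1 by rewrite /P rmorph1 subrr mul0r ideal_gen0.
rewrite -/(P h); elim/mpolyind: h => [|c m p _ _ Pp].
  by rewrite /P rmorph0 subrr mul0r ideal_gen0.
have Pcm : P (c *: 'X_[m]).
  rewrite -mul_mpolyC; apply: (PM).
    by rewrite /P /restrict_vars comp_mpolyC subrr mul0r ideal_gen0.
  rewrite mpolyXE_id; apply: (big_ind P P1 PM) => i _.
  elim: (m i) => [|n IHn]; first by rewrite expr0.
  rewrite exprS; apply: PM => //; rewrite /P restrict_varsX.
  case: ifPn => [_|iA]; first by rewrite subrr mul0r ideal_gen0.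
  by rewrite subr0 maxset_stable_mulX.
by rewrite /P rmorphD /= opprD addrACA mulrDl ideal_genD.
Qed.

Lemma colon_edge_monomial A : maxset (stable C) A ->
  colon (edge_ideal K C) (edge_monomial K A)
    =i [pred h | restrict_vars A h == 0].
Proof.
move=> maxA h; rewrite !inE; apply/idP/eqP => [hI|h0].
  (* The morphism fixes [edge_monomial K A], a nonzero element of a domain, which can thus be
     cancelled. *)
  have := restrict_vars_ideal (maxsetp maxA) hI.
  rewrite rmorphM /= restrict_vars_edge_monomial => /eqP.
  by rewrite mulf_eq0 (negPf (edge_monomial_neq0 A)) orbF => /eqP.
by have := restrict_vars_mul_ideal h maxA; rewrite h0 subr0.
Qed.

(** The kernel of [restrict_vars A] is prime since the morphism lands in a domain. The same monomial
    shows that this prime is associated and serves as the homogeneous [f]. *)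
Lemma maxset_stable_vnumber_witness A : maxset (stable C) A ->
  vnumber_witness (edge_ideal K C) #|A|.
Proof.
move=> maxA.
exists (edge_monomial K A), (fun h => restrict_vars A h == 0).
split; [exact: edge_monomial_dhomog | | exact: colon_edge_monomial].
split; last by exists (edge_monomial K A); exact: colon_edge_monomial.
- split=> [||a u v]; rewrite !unfold_in ?rmorph0 ?rmorph1 ?oner_eq0 //.
  by move=> /eqP u0 /eqP v0; rewrite rmorphD rmorphM /= u0 v0 mulr0 addr0.
- by move=> u v; rewrite !unfold_in rmorphM mulf_eq0.
Qed.

Lemma independent_domination_number_le A :
  maxset (stable C) A -> (independent_domination_number C <= #|A|)%N.
Proof.
move=> maxA.
by rewrite /independent_domination_number -minEnat -leEnat bigmin_le_cond.
Qed.

Lemma independent_domination_numberP :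
  exists2 A, maxset (stable C) A & independent_domination_number C = #|A|.
Proof.
have [A0 maxA0] : {A | maxset (stable C) A}.
  by apply: ex_maxset; exists set0; exact: stable0.
case: (arg_minnP (fun A => #|A|) maxA0) => A maxA minA; exists A => //.
apply/eqP; rewrite eqn_leq independent_domination_number_le //=.
rewrite /independent_domination_number.
(* The bound [#|A|] must also lie below the default value [s] of the minimum. *)
elim/big_ind: _ => [|m n Am An|B maxB]; last exact: minA.
- by rewrite -[leqRHS]card_ord max_card.
- by rewrite leq_min Am.
Qed.

(** Well-ordering of the naturals; [asbool] makes the witness property decidable, as [ex_minnP]
    requires. *)
Lemma vnumber_exists (I : {pred {mpoly K[s]}}) d :
  vnumber_witness I d -> exists2 v, is_vnumber I v & (v <= d)%N.
Proof.
move=> wd; have exd : exists n, `[< vnumber_witness I n >].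
  by exists d; apply/asboolP.
case: (ex_minnP exd) => v /asboolP wv minv.
by exists v; [split=> // n wn|]; apply/minv/asboolP.
Qed.

End Clutter.

Theorem corollary3p6 (K : fieldType) (s : nat) (C : clutter s) :
  exists v : nat,
    is_vnumber (edge_ideal K C) v /\
    (v <= independent_domination_number C)%N /\
    (independent_domination_number C <= independence_number C)%N.
Proof.
have [A maxA ->] := independent_domination_numberP C.
have [v isv le_vA] := vnumber_exists (maxset_stable_vnumber_witness K maxA).
(* The set [A] attaining the minimum is itself stable, so its size is at most the independence
   number. *)
by exists v; do 2![split=> //]; apply: leq_bigmax_cond (maxsetp maxA).
Qed.
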